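(* Let $a_0<0$ and $a_1>0$ be arbitrary real numbers. Then the initial value problem $$f''(\eta) = - f(\eta)\, f'(\eta)\, \eta \quad (\eta\ge 0), \qquad f(0)=a_0, \quad f'(0)=a_1$$ has a unique solution $f\in C^\infty[0,+\infty)$. This solution is increasing and satisfies $$0< \lim_{\eta\to+\infty} f(\eta) <+\infty.$$
   Context: Functions are real-valued. $C^\infty[0,+\infty)$ denotes the functions on $[0,+\infty)$ that are infinitely differentiable, with one-sided derivatives at $0$. *)

(* Defs.v *)
From Stdlib Require Import Reals.
From Coquelicot Require Import Coquelicot.
Open Scope R_scope.

(* A function on [0,+oo) is represented by a total function R -> R of which
   only the values on [0,+oo) matter. *)
Definition half_line (x : R) : Prop := 0 <= x.

(* [D_in] takes difference quotients over points of [half_line] only, so this is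
   the ordinary derivative at x > 0 and the right derivative at 0. *)
Definition has_derivative (f f' : R -> R) : Prop :=
  forall x : R, half_line x -> D_in f f' half_line x.

Definition smooth (f : R -> R) : Prop :=
  exists d : nat -> R -> R,
    d 0%nat = f /\ forall n : nat, has_derivative (d n) (d (S n)).

Definition solves_ivp (a0 a1 : R) (f : R -> R) : Prop :=
  exists f' f'' : R -> R,
    has_derivative f f' /\ has_derivative f' f'' /\
    (forall eta : R, half_line eta -> f'' eta = - f eta * f' eta * eta) /\
    f 0 = a0 /\ f' 0 = a1.

Definition increasing_on_half_line (f : R -> R) : Prop :=
  forall x y : R, half_line x -> half_line y -> x < y -> f x < f y.

(* Main.v *)
(* A solution is a fixed point of
     Phi(f)(x) = a0 + int_0^x a1 exp(- int_0^s t f(t) dt) ds.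
   Phi preserves the condition f >= a0, and under that condition it is a
   contraction by 1/2 on every [0,T] for the norm sup |f(x)| exp(- w x) with w
   large, so the Picard iterates from the constant a0 converge globally.
   Uniqueness is Gronwall's inequality for (f - g)^2 + (f' - g')^2.  Since
   f' > 0, f is increasing; it cannot stay nonpositive, as then f'' >= 0 and f
   would grow linearly; and once f >= c > 0, f' + c f is nonincreasing, which
   bounds f. *)
Require Import Defs.
From Stdlib Require Import Reals Lra.
From Coquelicot Require Import Coquelicot.
Open Scope R_scope.

(** * Calculus with one-sided derivatives on the half line *)

Lemma has_derivative_ext (f f' g g' : R -> R) :
  (forall x, 0 <= x -> f x = g x) -> (forall x, 0 <= x -> f' x = g' x) ->
  has_derivative f f' -> has_derivative g g'.
Proof.
  intros Hf Hf' H x Hx eps Heps.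
  destruct (H x Hx eps Heps) as [d [Hd Hlim]].
  exists d; split; [exact Hd|].
  intros y [[Hy Hyx] Hdist].
  rewrite <- (Hf y Hy), <- (Hf x Hx), <- (Hf' x Hx).
  apply Hlim; repeat split; assumption.
Qed.

Lemma has_derivative_minus (f f' g g' : R -> R) :
  has_derivative f f' -> has_derivative g g' ->
  has_derivative (fun x => f x - g x) (fun x => f' x - g' x).
Proof. intros Hf Hg x Hx; apply Dminus; auto. Qed.

Lemma has_derivative_plus (f f' g g' : R -> R) :
  has_derivative f f' -> has_derivative g g' ->
  has_derivative (fun x => f x + g x) (fun x => f' x + g' x).
Proof. intros Hf Hg x Hx; apply Dadd; auto. Qed.

Lemma has_derivative_mult (f f' g g' : R -> R) :
  has_derivative f f' -> has_derivative g g' ->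
  has_derivative (fun x => f x * g x) (fun x => f' x * g x + f x * g' x).
Proof. intros Hf Hg x Hx; apply Dmult; auto. Qed.

Lemma has_derivative_const (c : R) :
  has_derivative (fun _ => c) (fun _ => 0).
Proof. intros x Hx; apply Dconst. Qed.

Lemma has_derivative_id : has_derivative (fun x => x) (fun _ => 1).
Proof. intros x Hx; apply Dx. Qed.

Lemma is_derive_has_derivative (f f' : R -> R) :
  (forall x, is_derive f x (f' x)) -> has_derivative f f'.
Proof.
  intros H x Hx.
  apply D_in_imp with no_cond; [now intros|].
  apply derivable_pt_lim_D_in, is_derive_Reals, H.
Qed.

Lemma has_derivative_is_derive (f f' : R -> R) (x : R) :
  has_derivative f f' -> 0 < x -> is_derive f x (f' x).
Proof.
  intros H Hx; apply is_derive_Reals; intros eps Heps.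
  destruct (H x (Rlt_le _ _ Hx) eps Heps) as [d [Hd Hlim]].
  (* Increments smaller than [x] keep [x + h] in the half line, where the restricted difference
     quotient is the ordinary one. *)
  assert (Hm : 0 < Rmin d x) by (apply Rmin_pos; lra).
  exists (mkposreal _ Hm); intros h Hh0 Hh; simpl in Hh.
  pose proof (Rmin_l d x); pose proof (Rmin_r d x).
  assert (Hy : half_line (x + h)).
  { unfold half_line; unfold Rabs in Hh; destruct (Rcase_abs h); lra. }
  assert (Hne : x <> x + h) by lra.
  specialize (Hlim (x + h)); simpl in Hlim; unfold Rdist in Hlim.
  replace (x + h - x) with h in Hlim by ring.
  apply Hlim; split; [split; assumption | lra].
Qed.

(** Precomposing with the 1-Lipschitz projection [Rmax 0] gives a function continuous on all of R,
    to which two-sided results about compact intervals apply. *)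
Lemma has_derivative_Rmax_continuous (f f' : R -> R) :
  has_derivative f f' -> forall x, continuity_pt (fun y => f (Rmax 0 y)) x.
Proof.
  intros H x eps Heps.
  pose proof (Rmax_l 0 x) as Hx.
  assert (Hc : continue_in f half_line (Rmax 0 x)) by exact (cont_deriv _ _ _ _ (H _ Hx)).
  destruct (Hc eps Heps) as [d [Hd Hlim]].
  exists d; split; [exact Hd|]; intros y [_ Hy]; simpl in *.
  (* The limit in [continue_in] excludes the base point, but the projection can send [y] onto it. *)
  destruct (Req_dec (Rmax 0 y) (Rmax 0 x)) as [E|E].
  - rewrite E; unfold Rdist; rewrite Rminus_diag, Rabs_R0; exact Heps.
  - apply Hlim; split; [split; [apply Rmax_l | now apply not_eq_sym]|].
    apply Rle_lt_trans with (2 := Hy); unfold Rdist, Rmax.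
    destruct (Rle_dec 0 y), (Rle_dec 0 x); split_Rabs; lra.
Qed.

Lemma has_derivative_MVT (f f' : R -> R) (a b : R) :
  has_derivative f f' -> 0 <= a <= b ->
  exists c, a <= c <= b /\ f b - f a = f' c * (b - a).
Proof.
  intros H [Ha Hab].
  destruct Hab as [Hab|<-]; [|exists a; lra].
  destruct (MVT_gen (fun y => f (Rmax 0 y)) a b (fun y => f' (Rmax 0 y)))
    as [c [Hc E]].
  - rewrite Rmin_left, Rmax_right by lra; intros x Hx.
    (* Interior points are positive, so the projection is the identity near them; at the endpoints
       continuity suffices. *)
    apply is_derive_ext_loc with f.
    + apply (locally_interval _ x 0 p_infty); simpl; try easy; [lra|].
      intros y Hy _; rewrite Rmax_right; lra.
    + rewrite Rmax_right by lra; apply has_derivative_is_derive; [exact H | lra].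
  - intros x _; exact (has_derivative_Rmax_continuous _ _ H x).
  - rewrite Rmin_left, Rmax_right in Hc by lra.
    exists c; split; [exact Hc|].
    rewrite !Rmax_right in E by lra; exact E.
Qed.

Lemma has_derivative_nondecreasing (f f' : R -> R) (a b : R) :
  has_derivative f f' -> 0 <= a <= b ->
  (forall x, a <= x <= b -> 0 <= f' x) -> f a <= f b.
Proof.
  intros H Hab Hpos.
  destruct (has_derivative_MVT f f' a b H Hab) as [c [Hc E]].
  pose proof (Rmult_le_pos _ (b - a) (Hpos c Hc)); lra.
Qed.

(** Both [v - u] and [v + u] are nondecreasing. This plays the role of bounding an integral by the
    integral of a majorant. *)
Lemma has_derivative_comparison (u u' v v' : R -> R) (a b : R) :
  has_derivative u u' -> has_derivative v v' -> 0 <= a <= b ->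
  (forall x, a <= x <= b -> Rabs (u' x) <= v' x) ->
  Rabs (u b - u a) <= v b - v a.
Proof.
  intros Hu Hv Hab Hle.
  assert (H1 : v a - u a <= v b - u b).
  { apply (has_derivative_nondecreasing (fun x => v x - u x) (fun x => v' x - u' x));
      [now apply has_derivative_minus | exact Hab|].
    intros x Hx; specialize (Hle x Hx); apply Rabs_le_between in Hle; lra. }
  assert (H2 : v a + u a <= v b + u b).
  { apply (has_derivative_nondecreasing (fun x => v x + u x) (fun x => v' x + u' x));
      [now apply has_derivative_plus | exact Hab|].
    intros x Hx; specialize (Hle x Hx); apply Rabs_le_between in Hle; lra. }
  apply Rabs_le; lra.
Qed.

Lemma has_derivative_bounded (f f' : R -> R) (T : R) :
  has_derivative f f' -> 0 <= T ->
  exists M, forall x, 0 <= x <= T -> Rabs (f x) <= M.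
Proof.
  intros H HT.
  destruct (continuity_ab_maj (fun y => Rabs (f (Rmax 0 y))) 0 T HT) as [m [Hm _]].
  - intros x _; apply (continuity_pt_comp (fun y => f (Rmax 0 y)) Rabs).
    + exact (has_derivative_Rmax_continuous _ _ H x).
    + apply Rcontinuity_abs.
  - exists (Rabs (f (Rmax 0 m))); intros x Hx.
    specialize (Hm x Hx); rewrite (Rmax_right 0 x) in Hm by lra; exact Hm.
Qed.

(** * Smoothness of solutions *)

Inductive jet_poly : Type :=
  | JX | JF | JF' | JConst (c : R)
  | JAdd (p q : jet_poly) | JMul (p q : jet_poly).

Fixpoint jet_eval (f f' : R -> R) (p : jet_poly) : R -> R :=
  match p with
  | JX => fun x => x
  | JF => f
  | JF' => f'
  | JConst c => fun _ => c
  | JAdd p q => fun x => jet_eval f f' p x + jet_eval f f' q x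
  | JMul p q => fun x => jet_eval f f' p x * jet_eval f f' q x
  end.

Fixpoint jet_deriv (p : jet_poly) : jet_poly :=
  match p with
  | JX => JConst 1
  | JF => JF'
  (* The second derivative is eliminated through the differential equation. *)
  | JF' => JMul (JMul (JMul (JConst (-1)) JF) JF') JX
  | JConst _ => JConst 0
  | JAdd p q => JAdd (jet_deriv p) (jet_deriv q)
  | JMul p q => JAdd (JMul (jet_deriv p) q) (JMul p (jet_deriv q))
  end.

(* The equation makes the polynomials in x, f, f' closed under differentiation. *)
Lemma solves_ivp_smooth (a0 a1 : R) (f : R -> R) :
  solves_ivp a0 a1 f -> smooth f.
Proof.
  intros [f' [f'' [Hf [Hf' [Heq _]]]]].
  exists (fun n => jet_eval f f' (Nat.iter n jet_deriv JF)).
  split; [reflexivity|]; intro n; simpl.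
  (* The claim holds for every polynomial, so the induction runs on the syntax tree and not on
     [n]. *)
  induction (Nat.iter n jet_deriv JF) as [| | |c|p IHp q IHq|p IHp q IHq]; simpl.
  - apply has_derivative_id.
  - exact Hf.
  - apply (has_derivative_ext f' f''); [reflexivity | | exact Hf'].
    intros x Hx; rewrite (Heq x Hx); ring.
  - apply has_derivative_const.
  - now apply has_derivative_plus.
  - now apply has_derivative_mult.
Qed.

(** * Uniqueness *)

Lemma gronwall_zero (E E' : R -> R) (C T : R) :
  has_derivative E E' -> 0 <= T -> E 0 = 0 ->
  (forall x, 0 <= x <= T -> E' x <= C * E x) -> E T <= 0.
Proof.
  intros HE HT HE0 Hle.
  assert (Hexp : has_derivative (fun x => exp (- C * x)) (fun x => - C * exp (- C * x))).
  { apply is_derive_has_derivative; intro x; auto_derive; [easy | ring]. }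
  (* The integrating factor makes [E x * exp (- C * x)] nonincreasing, and it starts at 0. *)
  assert (H : - (E 0 * exp (- C * 0)) <= - (E T * exp (- C * T))).
  { apply (has_derivative_nondecreasing (fun x => - (E x * exp (- C * x)))
      (fun x => (C * E x - E' x) * exp (- C * x))); [ | lra | ].
    - apply (has_derivative_ext (fun x => 0 - E x * exp (- C * x))
        (fun x => 0 - (E' x * exp (- C * x) + E x * (- C * exp (- C * x))))).
      + intros; ring.
      + intros; ring.
      + apply has_derivative_minus; [apply has_derivative_const|].
        now apply has_derivative_mult.
    - intros x Hx; apply Rmult_le_pos; [specialize (Hle x Hx); lra|].
      apply Rlt_le, exp_pos. }
  rewrite HE0 in H; pose proof (exp_pos (- C * T)).
  destruct (Rle_or_lt (E T) 0); [assumption|].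
  pose proof (Rmult_lt_0_compat (E T) (exp (- C * T))); lra.
Qed.

Lemma solves_ivp_unique (a0 a1 : R) (f g : R -> R) :
  solves_ivp a0 a1 f -> solves_ivp a0 a1 g ->
  forall x, 0 <= x -> g x = f x.
Proof.
  intros [f1 [f2 [Hf [Hf1 [Heqf [Hf0 Hf10]]]]]] [g1 [g2 [Hg [Hg1 [Heqg [Hg0 Hg10]]]]]] T HT.
  destruct (has_derivative_bounded f1 f2 T Hf1 HT) as [A HA].
  destruct (has_derivative_bounded g g1 T Hg HT) as [B HB].
  assert (Hu := has_derivative_minus _ _ _ _ Hf Hg).
  assert (Hv := has_derivative_minus _ _ _ _ Hf1 Hg1).
  assert (HE := has_derivative_plus _ _ _ _
    (has_derivative_mult _ _ _ _ Hu Hu) (has_derivative_mult _ _ _ _ Hv Hv)).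
  cbv beta in HE.
  (* With p = x f'(x) and q = x g(x), the energy u^2 + v^2 has derivative 2uv - 2puv - 2qv^2. The
     three terms are bounded by 1, T A and 2 T B times the energy. *)
  assert (H := gronwall_zero _ _ (1 + T * A + 2 * (T * B)) T HE HT).
  cbv beta in H.
  assert (HET : (f T - g T) * (f T - g T) + (f1 T - g1 T) * (f1 T - g1 T) <= 0).
  { apply H; [rewrite Hf0, Hg0, Hf10, Hg10; ring|].
    intros x Hx.
    rewrite (Heqf x (proj1 Hx)), (Heqg x (proj1 Hx)).
    specialize (HA x Hx); specialize (HB x Hx).
    set (u := f x - g x); set (v := f1 x - g1 x).
    assert (HuE : - f x * f1 x * x - - g x * g1 x * x = - (x * f1 x) * u - (x * g x) * v)
      by (unfold u, v; ring).
    rewrite HuE.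
    assert (H1 : Rabs (x * f1 x) <= T * A).
    { rewrite Rabs_mult, (Rabs_right x) by lra.
      apply Rmult_le_compat; try lra; apply Rabs_pos. }
    assert (H2 : Rabs (x * g x) <= T * B).
    { rewrite Rabs_mult, (Rabs_right x) by lra.
      apply Rmult_le_compat; try lra; apply Rabs_pos. }
    apply Rabs_le_between in H1; apply Rabs_le_between in H2.
    revert H1 H2; generalize (x * f1 x) (x * g x) (T * A) (T * B); intros p q P Q H1 H2.
    (* This and the next inequality add up to - 2puv <= P (u^2 + v^2); the other three handle -
       2qv^2 and 2uv. *)
    assert (0 <= (P + p) * (u + v) ^ 2) by (apply Rmult_le_pos; [lra | apply pow2_ge_0]).
    assert (0 <= (P - p) * (u - v) ^ 2) by (apply Rmult_le_pos; [lra | apply pow2_ge_0]).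
    assert (0 <= (Q + q) * v ^ 2) by (apply Rmult_le_pos; [lra | apply pow2_ge_0]).
    assert (0 <= Q * u ^ 2) by (apply Rmult_le_pos; [lra | apply pow2_ge_0]).
    pose proof (pow2_ge_0 (u - v)).
    nra. }
  pose proof (Rle_0_sqr (f T - g T)); pose proof (Rle_0_sqr (f1 T - g1 T)).
  unfold Rsqr in *.
  assert (f T - g T = 0) by (apply Rsqr_0_uniq; unfold Rsqr; lra).
  lra.
Qed.

(** * Monotonicity and the limit at infinity *)

Lemma nondecreasing_bounded_is_lim (f : R -> R) (a M : R) :
  (forall x y, a <= x -> x <= y -> f x <= f y) -> (forall x, a <= x -> f x <= M) ->
  exists l : R, is_lim f p_infty l /\ forall x, a <= x -> f x <= l.
Proof.
  intros Hmon HM.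
  (* The limit is the supremum of the values; being an upper bound, it will inherit positivity from
     a single positive value. *)
  destruct (completeness (fun y => exists x, a <= x /\ y = f x)) as [l [Hub Hlub]].
  - exists M; intros y [x [Hx ->]]; auto.
  - exists (f a), a; split; [apply Rle_refl | reflexivity].
  - assert (Hl : forall x, a <= x -> f x <= l) by (intros x Hx; apply Hub; eauto).
    exists l; split; [|exact Hl].
    apply is_lim_spec; intro eps; pose proof (cond_pos eps).
    destruct (Classical_Prop.classic (exists x0, a <= x0 /\ l - eps < f x0))
      as [[x0 [Hx0 Hgt]]|Hno].
    + exists x0; intros x Hx.
      pose proof (Hmon x0 x Hx0 (Rlt_le _ _ Hx)); pose proof (Hl x ltac:(lra)).
      apply Rabs_def1; lra.
    + exfalso; apply (Rlt_irrefl l); apply Rle_lt_trans with (l - eps); [|lra].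
      apply Hlub; intros y [x [Hx ->]].
      destruct (Rle_or_lt (f x) (l - eps)); [assumption|].
      exfalso; apply Hno; eauto.
Qed.

Lemma positive_slope_increasing (f f' : R -> R) :
  has_derivative f f' -> (forall x, 0 <= x -> 0 < f' x) -> increasing_on_half_line f.
Proof.
  intros H Hpos x y Hx Hy Hxy; unfold half_line in *.
  destruct (has_derivative_MVT f f' x y H) as [c [Hc E]]; [lra|].
  pose proof (Rmult_lt_0_compat (f' c) (y - x) (Hpos c ltac:(lra))); lra.
Qed.

Lemma solution_limit (a0 a1 : R) (f f' f'' : R -> R) :
  0 < a1 ->
  has_derivative f f' -> has_derivative f' f'' ->
  (forall x, 0 <= x -> f'' x = - f x * f' x * x) ->
  f 0 = a0 -> f' 0 = a1 -> (forall x, 0 <= x -> 0 < f' x) ->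
  exists l : R, is_lim f p_infty l /\ 0 < l.
Proof.
  intros Ha1 Hf Hf' Heq Hf0 Hf'0 Hpos.
  assert (Hmon : forall x y, 0 <= x -> x <= y -> f x <= f y).
  { intros x y Hx [Hxy| <-]; [|lra].
    apply Rlt_le, (positive_slope_increasing f f'); unfold half_line; auto; lra. }
  (* Otherwise f'' >= 0 throughout, so f grows at least linearly. *)
  assert (Hex : exists x0, 0 <= x0 /\ 0 < f x0).
  (* Slope at least [a1] on [[0,X]] would give f(X) >= a0 + a1 X = a0 + |a0| + a1 > 0. *)
  { set (X := 1 + Rabs a0 / a1).
    assert (HX : 1 <= X).
    { unfold X; pose proof (Rdiv_le_0_compat (Rabs a0) a1 (Rabs_pos a0) Ha1); lra. }
    destruct (Rle_or_lt (f X) 0) as [HfX|HfX]; [exfalso | exists X; split; lra].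
    assert (Hslope : forall x, 0 <= x <= X -> a1 <= f' x).
    { intros x Hx; rewrite <- Hf'0.
      apply (has_derivative_nondecreasing f' f''); [exact Hf' | lra |].
      intros y Hy; rewrite Heq by lra.
      assert (f y <= 0) by (apply Rle_trans with (2 := HfX), Hmon; lra).
      apply Rmult_le_pos; [|lra].
      apply Rmult_le_pos; [lra | apply Rlt_le, Hpos; lra]. }
    destruct (has_derivative_MVT f f' 0 X Hf) as [c [Hc E]]; [lra|].
    pose proof (Rmult_le_compat_r (X - 0) _ _ ltac:(lra) (Hslope c Hc)).
    assert (a1 * (X - 0) = a1 + Rabs a0) by (unfold X; field; lra).
    pose proof (Rle_abs (- a0)); rewrite Rabs_Ropp in *; lra. }
  destruct Hex as [x0 [Hx0 Hfx0]].
  set (x1 := Rmax x0 1).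
  pose proof (Rmax_l x0 1 : x0 <= x1); pose proof (Rmax_r x0 1 : 1 <= x1).
  set (c := f x1).
  assert (Hc : 0 < c) by (apply Rlt_le_trans with (1 := Hfx0), Hmon; lra).
  (* f' + c f is nonincreasing on [x1,+oo), because f >= c and x >= 1 there. *)
  assert (Hbound : forall x, x1 <= x -> f x <= (f' x1 + c * c) / c).
  { intros x Hx.
    assert (Hdec : 0 - (f' x1 + c * f x1) <= 0 - (f' x + c * f x)).
    { apply (has_derivative_nondecreasing (fun t => 0 - (f' t + c * f t))
        (fun t => 0 - (f'' t + (0 * f t + c * f' t)))); [ | lra | ].
      - apply has_derivative_minus; [apply has_derivative_const|].
        apply has_derivative_plus; [exact Hf'|].
        apply (has_derivative_mult (fun _ => c) (fun _ => 0)); [|exact Hf].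
        apply has_derivative_const.
      - intros t Ht; rewrite Heq by lra.
        assert (c <= f t) by (apply Hmon; lra).
        assert (c * 1 <= f t * t) by (apply Rmult_le_compat; lra).
        pose proof (Rmult_le_pos (f t * t - c) (f' t) ltac:(lra)
          (Rlt_le _ _ (Hpos t ltac:(lra)))).
        lra. }
    (* Dropping the positive term f'(x) from f'(x) + c f(x) <= f'(x1) + c^2 leaves the bound on c
       f(x). *)
    apply (Rmult_le_reg_l c); [exact Hc|].
    replace (c * ((f' x1 + c * c) / c)) with (f' x1 + c * c) by (field; lra).
    pose proof (Hpos x ltac:(lra)); fold c in Hdec; lra. }
  destruct (nondecreasing_bounded_is_lim f x1 _ (fun x y Hx => Hmon x y ltac:(lra)) Hbound)
    as [l [Hl Hle]].
  exists l; split; [exact Hl|].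
  apply Rlt_le_trans with (1 := Hc), Hle, Rle_refl.
Qed.

(** * The Picard operator *)

Definition moment (f : R -> R) (x : R) : R := RInt (fun t => t * f t) 0 x.
(** With the coefficient [f] frozen, the equation is the linear one y' = - x f(x) y for the
    derivative; this is its solution with y(0) = a1. *)
Definition slope (a1 : R) (f : R -> R) (x : R) : R := a1 * exp (- moment f x).
Definition picard (a0 a1 : R) (f : R -> R) (x : R) : R := a0 + RInt (slope a1 f) 0 x.

(** Continuity on all of R gives a two-sided derivative even at 0, so that
    [is_derive_has_derivative] applies to everything built from such integrals. *)
Lemma is_derive_primitive (g : R -> R) (x : R) :
  (forall t, continuous g t) -> is_derive (fun y => RInt g 0 y) x (g x).
Proof.
  intros Hg; apply (is_derive_RInt g (fun y => RInt g 0 y) 0 x); [|apply Hg].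
  apply filter_forall; intro y; apply (@RInt_correct R_CompleteNormedModule).
  apply (@ex_RInt_continuous R_CompleteNormedModule); intros; apply Hg.
Qed.

Lemma primitive_0 (g : R -> R) : RInt g 0 0 = 0.
Proof. exact (@RInt_point R_CompleteNormedModule 0 g). Qed.

Lemma moment_0 (f : R -> R) : moment f 0 = 0.
Proof. apply primitive_0. Qed.

Lemma is_derive_moment (f : R -> R) (x : R) :
  (forall t, continuous f t) -> is_derive (moment f) x (x * f x).
Proof.
  intros Hf; apply (is_derive_primitive (fun t => t * f t)); intro t.
  apply (@continuous_mult R_UniformSpace R_AbsRing (fun t => t) f);
    [apply continuous_id | apply Hf].
Qed.

Lemma is_derive_slope (a1 : R) (f : R -> R) (x : R) :
  (forall t, continuous f t) ->
  is_derive (slope a1 f) x (- f x * slope a1 f x * x).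
Proof.
  intros Hf; pose proof (is_derive_moment f x Hf) as Hm.
  unfold slope; auto_derive; [now exists (x * f x)|].
  replace (Derive (fun y => moment f y) x) with (x * f x); [ring|].
  symmetry; now apply is_derive_unique.
Qed.

Lemma is_derive_picard (a0 a1 : R) (f : R -> R) (x : R) :
  (forall t, continuous f t) -> is_derive (picard a0 a1 f) x (slope a1 f x).
Proof.
  intros Hf; unfold picard.
  rewrite <- (Rplus_0_l (slope a1 f x)).
  apply (@is_derive_plus R_AbsRing R_NormedModule (fun _ => a0)).
  - apply (@is_derive_const R_AbsRing R_NormedModule).
  - apply is_derive_primitive; intro t.
    apply (@ex_derive_continuous R_AbsRing R_NormedModule).
    now eexists; apply is_derive_slope.
Qed.

Lemma picard_continuous (a0 a1 : R) (f : R -> R) :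
  (forall t, continuous f t) -> forall t, continuous (picard a0 a1 f) t.
Proof.
  intros Hf t; apply (@ex_derive_continuous R_AbsRing R_NormedModule).
  now eexists; apply is_derive_picard.
Qed.

Lemma slope_pos (a1 : R) (f : R -> R) (x : R) : 0 < a1 -> 0 < slope a1 f x.
Proof. intros; apply Rmult_lt_0_compat; [assumption | apply exp_pos]. Qed.

Lemma picard_0 (a0 a1 : R) (f : R -> R) : picard a0 a1 f 0 = a0.
Proof. unfold picard; rewrite primitive_0; ring. Qed.

Lemma slope_0 (a1 : R) (f : R -> R) : slope a1 f 0 = a1.
Proof. unfold slope; rewrite moment_0, Ropp_0, exp_0; ring. Qed.

Lemma picard_ge (a0 a1 : R) (f : R -> R) (x : R) :
  0 < a1 -> (forall t, continuous f t) -> 0 <= x -> a0 <= picard a0 a1 f x.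
Proof.
  intros Ha1 Hf Hx; rewrite <- (picard_0 a0 a1 f) at 1.
  apply (has_derivative_nondecreasing _ (slope a1 f)); [|lra|].
  - apply is_derive_has_derivative; intro; now apply is_derive_picard.
  - intros; now apply Rlt_le, slope_pos.
Qed.

(** * Contraction in the exponentially weighted norm *)

Lemma exp_nondecreasing (x y : R) : x <= y -> exp x <= exp y.
Proof. intros [H| ->]; [now apply Rlt_le, exp_increasing | apply Rle_refl]. Qed.

(* Bounds [slope a1 f] on [0,T] for every f >= a0. *)
Definition slope_bound (a0 a1 T : R) : R := a1 * exp (- a0 * T * T).

(** Since [a0] is negative, t f(t) >= a0 t >= a0 T on [[0,T]]; integrating over a length at most [T]
    gives a bound uniform in [x]. *)
Lemma moment_ge (a0 T : R) (f : R -> R) (x : R) :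
  a0 < 0 -> (forall t, continuous f t) -> (forall t, 0 <= t -> a0 <= f t) ->
  0 <= x <= T -> a0 * T * T <= moment f x.
Proof.
  intros Ha0 Hf Hge Hx.
  assert (H : a0 * T * 0 - moment f 0 >= a0 * T * x - moment f x).
  { apply Rle_ge, Ropp_le_cancel.
    apply Rle_trans with (moment f 0 - a0 * T * 0); [lra|].
    apply Rle_trans with (moment f x - a0 * T * x); [|lra].
    apply (has_derivative_nondecreasing (fun s => moment f s - a0 * T * s)
      (fun s => s * f s - a0 * T)); [|lra|].
    - apply has_derivative_minus; apply is_derive_has_derivative; intro s.
      + now apply is_derive_moment.
      + auto_derive; [easy | ring].
    - intros s Hs.
      pose proof (Rmult_le_compat_l s _ _ (proj1 Hs) (Hge s (proj1 Hs))).
      pose proof (Rmult_le_pos (T - s) (- a0) ltac:(lra) ltac:(lra)); lra. }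
  rewrite moment_0 in H.
  assert (0 <= T * (T - x)) by (apply Rmult_le_pos; lra).
  pose proof (Rmult_le_pos (- a0) (T * (T - x)) ltac:(lra) ltac:(assumption)); lra.
Qed.

Lemma slope_le (a0 a1 T : R) (f : R -> R) (x : R) :
  a0 < 0 -> 0 < a1 -> (forall t, continuous f t) -> (forall t, 0 <= t -> a0 <= f t) ->
  0 <= x <= T -> slope a1 f x <= slope_bound a0 a1 T.
Proof.
  intros Ha0 Ha1 Hf Hge Hx; apply Rmult_le_compat_l; [lra|].
  pose proof (moment_ge a0 T f x Ha0 Hf Hge Hx).
  apply exp_nondecreasing; lra.
Qed.

(** For p <= q, exp q - exp p = exp q (1 - exp (p - q)) <= exp q (q - p), by 1 + t <= exp t. *)
Lemma exp_lipschitz (B u v : R) :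
  u <= B -> v <= B -> Rabs (exp u - exp v) <= exp B * Rabs (u - v).
Proof.
  assert (H : forall p q, p <= q -> q <= B -> exp q - exp p <= exp B * (q - p)).
  { intros p q Hpq HqB.
    assert (exp p = exp q * exp (p - q)) by (rewrite <- exp_plus; f_equal; ring).
    pose proof (exp_ineq1_le (p - q)).
    pose proof (exp_pos q); pose proof (exp_nondecreasing q B HqB).
    pose proof (Rmult_le_compat_l (exp q) _ _ ltac:(lra) H0).
    pose proof (Rmult_le_compat_r (q - p) (exp q) (exp B) ltac:(lra) ltac:(lra)); lra. }
  intros Hu Hv; destruct (Rle_or_lt u v) as [Huv|Huv].
  - pose proof (exp_nondecreasing u v Huv).
    rewrite !(Rabs_left1 (_ - _)) by lra; specialize (H u v Huv Hv); lra.
  - pose proof (exp_nondecreasing v u (Rlt_le _ _ Huv)).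
    rewrite !(Rabs_right (_ - _)) by lra; apply H; lra.
Qed.

(* The rate w of the exponential weight: twice the Lipschitz constant K T^2 of the
   slope on [0,T], where K is [slope_bound]; adding 1 gives w >= 1 also at T = 0. *)
Definition weight (a0 a1 T : R) : R := 2 * (slope_bound a0 a1 T * T * T) + 1.

Lemma slope_bound_pos (a0 a1 T : R) : 0 < a1 -> 0 < slope_bound a0 a1 T.
Proof. intros; apply Rmult_lt_0_compat; [assumption | apply exp_pos]. Qed.

Lemma weight_ge_1 (a0 a1 T : R) : 0 < a1 -> 0 <= T -> 1 <= weight a0 a1 T.
Proof.
  intros Ha1 HT; pose proof (slope_bound_pos a0 a1 T Ha1); unfold weight.
  pose proof (Rmult_le_pos (slope_bound a0 a1 T * T) T
    (Rmult_le_pos _ _ (Rlt_le _ _ H) HT) HT); lra.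
Qed.

(** The slopes differ by at most K T^2 M exp(w s). Integration gains a factor 1/w, and w >= 2 K T^2
    leaves the factor 1/2. *)
Lemma picard_contraction (a0 a1 T M : R) (f g : R -> R) :
  a0 < 0 -> 0 < a1 ->
  (forall t, continuous f t) -> (forall t, 0 <= t -> a0 <= f t) ->
  (forall t, continuous g t) -> (forall t, 0 <= t -> a0 <= g t) ->
  0 <= M ->
  (forall t, 0 <= t <= T -> Rabs (f t - g t) <= M * exp (weight a0 a1 T * t)) ->
  forall x, 0 <= x <= T ->
    Rabs (picard a0 a1 f x - picard a0 a1 g x) <= M / 2 * exp (weight a0 a1 T * x).
Proof.
  intros Ha0 Ha1 Hf Hfge Hg Hgge HM Hfg x Hx.
  assert (HT : 0 <= T) by lra.
  pose proof (weight_ge_1 a0 a1 T Ha1 HT) as Hw1.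
  pose proof (slope_bound_pos a0 a1 T Ha1) as HK.
  assert (HwK : slope_bound a0 a1 T * T * T <= weight a0 a1 T / 2) by (unfold weight; lra).
  set (w := weight a0 a1 T) in *; set (K := slope_bound a0 a1 T) in *.
  (* On [[0,s]] the weight is at most its value at [s]. One factor [T] bounds the variable t in the
     integrand, the other the length of the interval. *)
  assert (Hmoment : forall s, 0 <= s <= T ->
    Rabs (moment f s - moment g s) <= T * T * (M * exp (w * s))).
  { intros s Hs.
    pose proof (has_derivative_comparison (fun t => moment f t - moment g t)
      (fun t => t * f t - t * g t) (fun t => T * (M * exp (w * s)) * t)
      (fun _ => T * (M * exp (w * s))) 0 s) as H.
    cbv beta in H; rewrite !moment_0 in H.
    replace (moment f s - moment g s) with (moment f s - moment g s - (0 - 0)) by ring.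
    pose proof (exp_pos (w * s)) as He.
    assert (HMe : 0 <= M * exp (w * s)) by (apply Rmult_le_pos; lra).
    apply Rle_trans with (T * (M * exp (w * s)) * s - T * (M * exp (w * s)) * 0).
    - apply H; [ | | lra | ].
      + apply has_derivative_minus; apply is_derive_has_derivative;
          intro; now apply is_derive_moment.
      + apply is_derive_has_derivative; intro t; auto_derive; [easy | ring].
      + intros t Ht; rewrite <- Rmult_minus_distr_l, Rabs_mult, (Rabs_right t) by lra.
        apply Rmult_le_compat; [lra | apply Rabs_pos | lra |].
        apply Rle_trans with (1 := Hfg t ltac:(lra)).
        apply Rmult_le_compat_l; [exact HM|]; apply exp_nondecreasing.
        apply Rmult_le_compat_l; lra.
    - pose proof (Rmult_le_pos (T * (M * exp (w * s))) (T - s)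
        (Rmult_le_pos _ _ HT HMe) ltac:(lra)); lra. }
  pose proof (has_derivative_comparison
    (fun s => picard a0 a1 f s - picard a0 a1 g s)
    (fun s => slope a1 f s - slope a1 g s)
    (fun s => M / 2 * exp (w * s)) (fun s => M / 2 * (w * exp (w * s))) 0 x) as H.
  cbv beta in H; rewrite !picard_0 in H.
  replace (picard a0 a1 f x - picard a0 a1 g x)
    with (picard a0 a1 f x - picard a0 a1 g x - (a0 - a0)) by ring.
  apply Rle_trans with (M / 2 * exp (w * x) - M / 2 * exp (w * 0)).
  - apply H; [ | | lra | ].
    + apply has_derivative_minus; apply is_derive_has_derivative;
        intro; now apply is_derive_picard.
    + apply is_derive_has_derivative; intro t; auto_derive; [easy | ring].
    + intros s Hs.
      unfold slope; rewrite <- Rmult_minus_distr_l, Rabs_mult, (Rabs_right a1) by lra.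
      pose proof (moment_ge a0 T f s Ha0 Hf Hfge ltac:(lra)).
      pose proof (moment_ge a0 T g s Ha0 Hg Hgge ltac:(lra)).
      (* Both exponents lie below the one in [slope_bound], so [a1] times the Lipschitz constant of
         exp is exactly [K]. *)
      pose proof (exp_lipschitz (- a0 * T * T) (- moment f s) (- moment g s)
        ltac:(lra) ltac:(lra)) as Hexp.
      replace (- moment f s - - moment g s) with (- (moment f s - moment g s)) in Hexp by ring.
      rewrite Rabs_Ropp in Hexp.
      apply (Rmult_le_compat_l a1) in Hexp; [|lra].
      apply Rle_trans with (1 := Hexp); rewrite <- Rmult_assoc; fold (slope_bound a0 a1 T); fold K.
      pose proof (Rmult_le_compat_l K _ _ (Rlt_le _ _ HK) (Hmoment s ltac:(lra))).
      pose proof (exp_pos (w * s)) as He.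
      assert (HMe : 0 <= M * exp (w * s)) by (apply Rmult_le_pos; lra).
      pose proof (Rmult_le_compat_r _ _ _ HMe HwK); lra.
  - rewrite Rmult_0_r, exp_0; lra.
Qed.

(** * Convergence of the Picard iterates *)

Lemma geometric_cauchy (u : nat -> R) (C : R) :
  (forall n, Rabs (u (S n) - u n) <= C * (1 / 2) ^ n) ->
  exists l : R, is_lim_seq u l /\ forall n, Rabs (l - u n) <= 2 * C * (1 / 2) ^ n.
Proof.
  intros H.
  (* The half-width is the sum of all remaining steps, so these brackets are nested; the limit lies
     in each of them, which is the error bound. *)
  set (lo n := u n - 2 * C * (1 / 2) ^ n); set (hi n := u n + 2 * C * (1 / 2) ^ n).
  assert (Hgeo : is_lim_seq (fun n => 2 * C * (1 / 2) ^ n) 0).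
  { replace (Finite 0) with (Rbar_mult (2 * C) 0) by (simpl; f_equal; ring).
    apply is_lim_seq_scal_l, is_lim_seq_geom; rewrite Rabs_right; lra. }
  assert (Hlo : forall n, lo n <= lo (S n)).
  { intro n; specialize (H n); apply Rabs_le_between in H; unfold lo; simpl; lra. }
  assert (Hhi : forall n, hi (S n) <= hi n).
  { intro n; specialize (H n); apply Rabs_le_between in H; unfold hi; simpl; lra. }
  destruct (ex_lim_seq_adj lo hi Hlo Hhi) as [[l Hl] _].
  { apply is_lim_seq_ext with (fun n => 2 * (2 * C * (1 / 2) ^ n)).
    - intro n; unfold lo, hi; ring.
    - replace (Finite 0) with (Rbar_mult 2 0) by (simpl; f_equal; ring).
      now apply is_lim_seq_scal_l. }
  assert (Hu : is_lim_seq u l).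
  { apply is_lim_seq_ext with (fun n => lo n + 2 * C * (1 / 2) ^ n).
    - intro n; unfold lo; ring.
    - rewrite <- (Rplus_0_r l); now apply is_lim_seq_plus'. }
  assert (Hl' : is_lim_seq hi l).
  { unfold hi; rewrite <- (Rplus_0_r l); now apply is_lim_seq_plus'. }
  exists l; split; [exact Hu|]; intro n.
  pose proof (is_lim_seq_incr_compare lo l Hl Hlo n).
  pose proof (is_lim_seq_decr_compare hi l Hl' Hhi n).
  unfold lo, hi in *; apply Rabs_le; lra.
Qed.

Fixpoint iterate (a0 a1 : R) (n : nat) : R -> R :=
  match n with
  | O => fun _ => a0
  | S n => picard a0 a1 (iterate a0 a1 n)
  end.

Lemma iterate_continuous (a0 a1 : R) (n : nat) (t : R) :
  continuous (iterate a0 a1 n) t.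
Proof.
  revert t; induction n as [|n IH]; intro t; simpl.
  - apply continuous_const.
  - now apply picard_continuous.
Qed.

Lemma iterate_ge (a0 a1 : R) (n : nat) (t : R) :
  0 < a1 -> 0 <= t -> a0 <= iterate a0 a1 n t.
Proof.
  intros Ha1 Ht; destruct n as [|n]; simpl; [apply Rle_refl|].
  apply picard_ge; auto; apply iterate_continuous.
Qed.

Lemma picard_lipschitz (a0 a1 T : R) (f : R -> R) (x y : R) :
  a0 < 0 -> 0 < a1 -> (forall t, continuous f t) -> (forall t, 0 <= t -> a0 <= f t) ->
  0 <= x <= T -> 0 <= y <= T ->
  Rabs (picard a0 a1 f x - picard a0 a1 f y) <= slope_bound a0 a1 T * Rabs (x - y).
Proof.
  intros Ha0 Ha1 Hf Hge.
  assert (H : forall p q, 0 <= p <= q -> q <= T ->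
    Rabs (picard a0 a1 f q - picard a0 a1 f p) <= slope_bound a0 a1 T * (q - p)).
  { intros p q Hpq HqT; rewrite Rmult_minus_distr_l.
    apply (has_derivative_comparison _ (slope a1 f) (fun s => slope_bound a0 a1 T * s)
      (fun _ => slope_bound a0 a1 T)); [ | | lra | ].
    - apply is_derive_has_derivative; intro; now apply is_derive_picard.
    - apply is_derive_has_derivative; intro s; auto_derive; [easy | ring].
    - intros s Hs; rewrite Rabs_right by (apply Rle_ge, Rlt_le, slope_pos, Ha1).
      apply slope_le; auto; lra. }
  intros Hx Hy; destruct (Rle_or_lt x y).
  - rewrite Rabs_minus_sym, (Rabs_minus_sym x), (Rabs_right (y - x)) by lra; apply H; lra.
  - rewrite (Rabs_right (x - y)) by lra; apply H; lra.
Qed.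

(** The constant is independent of [n], so the estimate passes to the limit and makes [iterate_lim]
    continuous. *)
Lemma iterate_lipschitz (a0 a1 T : R) (n : nat) (x y : R) :
  a0 < 0 -> 0 < a1 -> 0 <= x <= T -> 0 <= y <= T ->
  Rabs (iterate a0 a1 n x - iterate a0 a1 n y) <= slope_bound a0 a1 T * Rabs (x - y).
Proof.
  intros Ha0 Ha1 Hx Hy; destruct n as [|n]; simpl.
  - rewrite Rminus_diag, Rabs_R0.
    apply Rmult_le_pos; [now apply Rlt_le, slope_bound_pos | apply Rabs_pos].
  - apply picard_lipschitz; auto; intros.
    + apply iterate_continuous.
    + now apply iterate_ge.
Qed.

(** The first step is at most K T; the exponential is the largest value of the weight on [[0,T]] and
    turns the weighted estimate into a uniform one. *)
Definition iterate_rate (a0 a1 T : R) : R :=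
  slope_bound a0 a1 T * T * exp (weight a0 a1 T * T).

Lemma iterate_step (a0 a1 T : R) (n : nat) (x : R) :
  a0 < 0 -> 0 < a1 -> 0 <= x <= T ->
  Rabs (iterate a0 a1 (S n) x - iterate a0 a1 n x) <= iterate_rate a0 a1 T * (1 / 2) ^ n.
Proof.
  intros Ha0 Ha1 Hx.
  pose proof (slope_bound_pos a0 a1 T Ha1) as HK.
  assert (HT : 0 <= T) by lra.
  pose proof (weight_ge_1 a0 a1 T Ha1 HT) as Hw.
  assert (HKT : 0 <= slope_bound a0 a1 T * T) by (apply Rmult_le_pos; lra).
  assert (Hhalf : forall n, 0 < (1 / 2) ^ n) by (intro; apply pow_lt; lra).
  (* The induction keeps the weight at [s], since the contraction holds only in the weighted
     norm. *)
  assert (H : forall s, 0 <= s <= T ->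
    Rabs (iterate a0 a1 (S n) s - iterate a0 a1 n s)
    <= slope_bound a0 a1 T * T * (1 / 2) ^ n * exp (weight a0 a1 T * s)).
  { induction n as [|n IH]; intros s Hs.
    - assert (He : 1 <= exp (weight a0 a1 T * s)).
      { rewrite <- exp_0; apply exp_nondecreasing, Rmult_le_pos; lra. }
      simpl; rewrite Rmult_1_r.
      apply Rle_trans with (slope_bound a0 a1 T * T);
        [|pose proof (Rmult_le_compat_l _ _ _ HKT He); lra].
      (* Reading [a0] as the value of the first iterate at 0 turns the first step into an increment
         over [[0,s]]. *)
      rewrite <- (picard_0 a0 a1 (fun _ => a0)) at 2.
      apply Rle_trans with (slope_bound a0 a1 T * Rabs (s - 0)).
      + apply picard_lipschitz; auto; try lra.
        * intro; apply continuous_const.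
        * intros; apply Rle_refl.
      + rewrite Rminus_0_r, Rabs_right by lra; apply Rmult_le_compat_l; lra.
    - replace (slope_bound a0 a1 T * T * (1 / 2) ^ S n)
        with (slope_bound a0 a1 T * T * (1 / 2) ^ n / 2) by (simpl; field).
      apply (picard_contraction a0 a1 T _ (iterate a0 a1 (S n)) (iterate a0 a1 n)); auto;
        try (intro; apply iterate_continuous); try (intros; now apply iterate_ge).
      apply Rmult_le_pos; [exact HKT | apply Rlt_le, Hhalf]. }
  apply Rle_trans with (1 := H x Hx); unfold iterate_rate.
  rewrite Rmult_assoc, (Rmult_comm (_ ^ n)), <- Rmult_assoc.
  apply Rmult_le_compat_r; [apply Rlt_le, Hhalf|].
  apply Rmult_le_compat_l; [exact HKT|].
  apply exp_nondecreasing, Rmult_le_compat_l; lra.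
Qed.

(* [Rmax 0 x] extends the limit continuously to x < 0, where the iterates need not converge. *)
Definition iterate_lim (a0 a1 x : R) : R :=
  real (Lim_seq (fun n => iterate a0 a1 n (Rmax 0 x))).

(** Only the rate depends on [T]: the estimates on all intervals [[0,T]] concern one global
    limit. *)
Lemma iterate_lim_spec (a0 a1 T x : R) :
  a0 < 0 -> 0 < a1 -> 0 <= x <= T ->
  is_lim_seq (fun n => iterate a0 a1 n x) (iterate_lim a0 a1 x) /\
  forall n, Rabs (iterate_lim a0 a1 x - iterate a0 a1 n x)
            <= 2 * iterate_rate a0 a1 T * (1 / 2) ^ n.
Proof.
  intros Ha0 Ha1 Hx; unfold iterate_lim; rewrite Rmax_right by lra.
  destruct (geometric_cauchy (fun n => iterate a0 a1 n x) (iterate_rate a0 a1 T))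
    as [l [Hl Hle]].
  - intro n; now apply iterate_step.
  - rewrite (is_lim_seq_unique _ _ Hl); simpl; now split.
Qed.

Lemma iterate_lim_ge (a0 a1 x : R) :
  a0 < 0 -> 0 < a1 -> 0 <= x -> a0 <= iterate_lim a0 a1 x.
Proof.
  intros Ha0 Ha1 Hx.
  destruct (iterate_lim_spec a0 a1 x x Ha0 Ha1) as [Hl _]; [lra|].
  apply (is_lim_seq_le (fun _ => a0) (fun n => iterate a0 a1 n x) a0 (iterate_lim a0 a1 x));
    [ | apply is_lim_seq_const | exact Hl].
  intro n; now apply iterate_ge.
Qed.

Lemma iterate_lim_continuous (a0 a1 x : R) :
  a0 < 0 -> 0 < a1 -> continuous (iterate_lim a0 a1) x.
Proof.
  intros Ha0 Ha1.
  (* The margin 1 keeps the projections of all points within distance 1 of [x] in [[0,T]], whence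
     the 1 in the choice of delta below. *)
  set (T := Rmax 0 x + 1).
  pose proof (Rmax_l 0 x) as Hx0.
  pose proof (slope_bound_pos a0 a1 T Ha1) as HK.
  assert (HL : forall y, Rmax 0 y <= T ->
    Rabs (iterate_lim a0 a1 y - iterate_lim a0 a1 x)
    <= slope_bound a0 a1 T * Rabs (y - x)).
  { intros y Hy; pose proof (Rmax_l 0 y) as Hy0.
    assert (Hproj : forall z, iterate_lim a0 a1 z = iterate_lim a0 a1 (Rmax 0 z)).
    { intro z; unfold iterate_lim; now rewrite (Rmax_right 0 (Rmax 0 z)) by apply Rmax_l. }
    rewrite (Hproj y), (Hproj x).
    apply Rle_trans with (slope_bound a0 a1 T * Rabs (Rmax 0 y - Rmax 0 x)).
    - destruct (iterate_lim_spec a0 a1 T (Rmax 0 y) Ha0 Ha1) as [Hly _]; [lra|].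
      destruct (iterate_lim_spec a0 a1 T (Rmax 0 x) Ha0 Ha1) as [Hlx _]; [unfold T; lra|].
      apply (is_lim_seq_le
        (fun n => Rabs (iterate a0 a1 n (Rmax 0 y) - iterate a0 a1 n (Rmax 0 x)))
        (fun _ => slope_bound a0 a1 T * Rabs (Rmax 0 y - Rmax 0 x))
        (Rabs (iterate_lim a0 a1 (Rmax 0 y) - iterate_lim a0 a1 (Rmax 0 x)))
        (slope_bound a0 a1 T * Rabs (Rmax 0 y - Rmax 0 x))).
      + intro n; apply iterate_lipschitz; auto; unfold T; lra.
      + apply (is_lim_seq_abs _ (Finite _)); now apply is_lim_seq_minus'.
      + apply is_lim_seq_const.
    - apply Rmult_le_compat_l; [lra|]; unfold Rmax.
      destruct (Rle_dec 0 y), (Rle_dec 0 x); split_Rabs; lra. }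
  apply continuity_pt_filterlim; intros eps Heps.
  assert (Hd : 0 < Rmin 1 (eps / slope_bound a0 a1 T)).
  { apply Rmin_pos; [lra | now apply Rdiv_lt_0_compat]. }
  exists (Rmin 1 (eps / slope_bound a0 a1 T)); split; [exact Hd|].
  intros y [_ Hy]; simpl in *; unfold Rdist in *.
  pose proof (Rmin_l 1 (eps / slope_bound a0 a1 T)).
  pose proof (Rmin_r 1 (eps / slope_bound a0 a1 T)).
  apply Rle_lt_trans with (slope_bound a0 a1 T * Rabs (y - x)).
  - apply HL; unfold T, Rmax in *.
    destruct (Rle_dec 0 y), (Rle_dec 0 x); split_Rabs; lra.
  - replace eps with (slope_bound a0 a1 T * (eps / slope_bound a0 a1 T)) by (field; lra).
    apply Rmult_lt_compat_l; lra.
Qed.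

(** The contraction, applied to the limit and the [n]-th iterate on [[0,x]], shows that the shifted
    iterates also tend to the Picard image of the limit. *)
Lemma iterate_lim_fixed (a0 a1 x : R) :
  a0 < 0 -> 0 < a1 -> 0 <= x ->
  picard a0 a1 (iterate_lim a0 a1) x = iterate_lim a0 a1 x.
Proof.
  intros Ha0 Ha1 Hx.
  set (C := 2 * iterate_rate a0 a1 x).
  assert (Hspec : forall t, 0 <= t <= x -> forall n,
    Rabs (iterate_lim a0 a1 t - iterate a0 a1 n t) <= C * (1 / 2) ^ n).
  { intros t Ht; exact (proj2 (iterate_lim_spec a0 a1 x t Ha0 Ha1 Ht)). }
  assert (HC : 0 <= C).
  { pose proof (Hspec x ltac:(lra) O) as H; simpl in H; rewrite Rmult_1_r in H.
    apply Rle_trans with (2 := H), Rabs_pos. }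
  pose proof (weight_ge_1 a0 a1 x Ha1 Hx) as Hw.
  assert (Hhalf : forall n, 0 < (1 / 2) ^ n) by (intro; apply pow_lt; lra).
  set (D := C / 2 * exp (weight a0 a1 x * x)).
  assert (Hn : forall n, Rabs (picard a0 a1 (iterate_lim a0 a1) x - iterate a0 a1 (S n) x)
    <= D * (1 / 2) ^ n).
  { intro n; unfold D.
    replace (C / 2 * exp (weight a0 a1 x * x) * (1 / 2) ^ n)
      with (C * (1 / 2) ^ n / 2 * exp (weight a0 a1 x * x)) by field.
    apply (picard_contraction a0 a1 x _ (iterate_lim a0 a1) (iterate a0 a1 n)); auto.
    - intro; now apply iterate_lim_continuous.
    - intros; now apply iterate_lim_ge.
    - intro; apply iterate_continuous.
    - intros; now apply iterate_ge.
    - apply Rmult_le_pos; [exact HC | apply Rlt_le, Hhalf].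
    - intros t Ht; apply Rle_trans with (1 := Hspec t Ht n).
      (* The weight is at least 1, so the uniform estimate implies the weighted one. *)
      assert (He : 1 <= exp (weight a0 a1 x * t)).
      { rewrite <- exp_0; apply exp_nondecreasing, Rmult_le_pos; lra. }
      pose proof (Rmult_le_compat_l (C * (1 / 2) ^ n) _ _
        (Rmult_le_pos _ _ HC (Rlt_le _ _ (Hhalf n))) He); lra.
    - lra. }
  assert (Hlim : is_lim_seq (fun n => iterate a0 a1 (S n) x)
    (picard a0 a1 (iterate_lim a0 a1) x)).
  { set (p := picard a0 a1 (iterate_lim a0 a1) x) in *.
    assert (Hgeo : is_lim_seq (fun n => D * (1 / 2) ^ n) 0).
    { replace (Finite 0) with (Rbar_mult D 0) by (simpl; f_equal; ring).
      apply is_lim_seq_scal_l, is_lim_seq_geom; rewrite Rabs_right; lra. }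
    apply is_lim_seq_le_le with (fun n => p - D * (1 / 2) ^ n) (fun n => p + D * (1 / 2) ^ n).
    - intro n; specialize (Hn n); apply Rabs_le_between in Hn; lra.
    - replace (Finite p) with (Finite (p - 0)) by (f_equal; ring).
      apply is_lim_seq_minus'; [apply is_lim_seq_const | exact Hgeo].
    - replace (Finite p) with (Finite (p + 0)) by (f_equal; ring).
      apply is_lim_seq_plus'; [apply is_lim_seq_const | exact Hgeo]. }
  destruct (iterate_lim_spec a0 a1 x x Ha0 Ha1) as [Hl _]; [lra|].
  apply is_lim_seq_incr_1 in Hl.
  pose proof (is_lim_seq_unique _ _ Hl) as E1; pose proof (is_lim_seq_unique _ _ Hlim) as E2.
  rewrite E1 in E2; injection E2; auto.
Qed.

Theorem proposition3p1 (a0 a1 : R) (ha0 : a0 < 0) (ha1 : 0 < a1) :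
  exists f : R -> R,
    (smooth f /\ solves_ivp a0 a1 f) /\
    (forall g : R -> R, smooth g -> solves_ivp a0 a1 g ->
       forall x : R, half_line x -> g x = f x) /\
    increasing_on_half_line f /\
    exists l : R, is_lim f p_infty (Finite l) /\ 0 < l.
Proof.
  set (F := iterate_lim a0 a1).
  assert (HF : forall t, continuous F t) by (intro; now apply iterate_lim_continuous).
  (* The Picard image of [F] is differentiable by construction. It agrees with [F] on the half line,
     which turns [F] into [f] in the formula for the second derivative. *)
  set (f := picard a0 a1 F); set (f' := slope a1 F).
  assert (Hf : has_derivative f f').
  { apply is_derive_has_derivative; intro; now apply is_derive_picard. }
  assert (Hf' : has_derivative f' (fun x => - F x * f' x * x)).
  { apply is_derive_has_derivative; intro; now apply is_derive_slope. }
  assert (Heq : forall x, 0 <= x -> - F x * f' x * x = - f x * f' x * x).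
  { intros x Hx; assert (E : f x = F x) by exact (iterate_lim_fixed a0 a1 x ha0 ha1 Hx).
    now rewrite E. }
  assert (Hpos : forall x, 0 <= x -> 0 < f' x) by (intros; now apply slope_pos).
  assert (Hsol : solves_ivp a0 a1 f).
  { exists f', (fun x => - F x * f' x * x); repeat split; auto.
    - apply picard_0.
    - apply slope_0. }
  exists f; split; [split; [exact (solves_ivp_smooth _ _ _ Hsol) | exact Hsol]|].
  split; [|split].
  - intros g _ Hg; exact (solves_ivp_unique a0 a1 f g Hsol Hg).
  - exact (positive_slope_increasing f f' Hf Hpos).
  - apply (solution_limit a0 a1 f f' _ ha1 Hf Hf' Heq); auto.
    + apply picard_0.
    + apply slope_0.
Qed.
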